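(* A bitopological space $(X,\tau_1,\tau_2)$ is pairwise weakly Lindelöf if and only if its pairwise semiregularization $(X,\tau^s_{(1,2)},\tau^s_{(2,1)})$ is pairwise weakly Lindelöf.
   Context: A bitopological space $(X,\tau_1,\tau_2)$ is a set $X$ with two topologies (no separation axioms assumed). For a topology $\sigma$ on $X$, $\sigma\text{-}\mathrm{int}$ and $\sigma\text{-}\mathrm{cl}$ denote interior and closure with respect to $\sigma$. For $i\ne j$ in $\{1,2\}$, a set $S\subseteq X$ is $(\tau_i,\tau_j)$-regular open if $\tau_i\text{-}\mathrm{int}(\tau_j\text{-}\mathrm{cl}(S))=S$. The topology on $X$ generated by the $(\tau_i,\tau_j)$-regular open sets (they are closed under finite intersections and form a base for it) is denoted $\tau^s_{(i,j)}$; the space $(X,\tau^s_{(1,2)},\tau^s_{(2,1)})$ is the pairwise semiregularization of $(X,\tau_1,\tau_2)$. For two topologies $\sigma,\sigma'$ on $X$, the space is $(\sigma,\sigma')$-weakly Lindelöf if for every cover $\{U_\alpha:\alpha\in\Delta\}$ of $X$ by $\sigma$-open sets there is a countable subset $\{\alpha_n:n\in\mathbb{N}\}$ of $\Delta$ with $X=\sigma'\text{-}\mathrm{cl}\left(\bigcup_{n\in\mathbb{N}}U_{\alpha_n}\right)$. A bitopological space $(X,\sigma_1,\sigma_2)$ is pairwise weakly Lindelöf if it is both $(\sigma_1,\sigma_2)$-weakly Lindelöf and $(\sigma_2,\sigma_1)$-weakly Lindelöf. *)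

(* Defs.v *)
From HB Require Import structures.
From mathcomp Require Import all_boot.
From mathcomp Require Import all_classical.
From mathcomp Require Import topology.

Set Implicit Arguments.
Unset Strict Implicit.
Unset Printing Implicit Defensive.

Local Open Scope classical_set_scope.

(* A bitopological space is a type [X] with two structures
   [t1 t2 : Topological X], as in the library's [sup_topology].  The choice
   structure that each of them carries is available on every type
   ([gen_choiceMixin]), and it restricts neither [X] nor the open sets. *)

Section Bitopological.
Context {X : Type}.
Implicit Types t s : Topological X.

Definition open_in t : set_system X := @open (Topological.Pack t).
Definition int_in t (A : set X) : set X := @interior (Topological.Pack t) A.
Definition cl_in t (A : set X) : set X := @closure (Topological.Pack t) A.

Definition pair_regopen ti tj (S : set X) : Prop := int_in ti (cl_in tj S) = S.

Definition semiregularization (ti tj : Topological X) : Type := X.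

End Bitopological.

Section Semiregularization.
Context {X : Type} (ti tj : Topological X).

HB.instance Definition _ :=
  Choice.copy (semiregularization ti tj) (Topological.Pack ti).
(* The generated topology: unions of finite intersections of (ti, tj)-regular
   open sets.  Such intersections are again (ti, tj)-regular open. *)
HB.instance Definition _ := isSubBaseTopological.Build
  (semiregularization ti tj) (pair_regopen ti tj) id.

Definition semireg_topology : Topological X :=
  Topological.class (semiregularization ti tj : topologicalType).

End Semiregularization.

Section WeaklyLindelof.
Context {X : Type}.
Implicit Types t s : Topological X.

(* The countable subfamily may be finite, or empty when [X] is empty. *)
Definition weakly_lindelof s s' : Prop :=
  forall (D : Type) (U : D -> set X),
    (forall a, open_in s (U a)) -> \bigcup_a U a = [set: X] ->
    exists2 C : set D, countable C &
      cl_in s' (\bigcup_(a in C) U a) = [set: X].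

Definition pairwise_weakly_lindelof s1 s2 : Prop :=
  weakly_lindelof s1 s2 /\ weakly_lindelof s2 s1.

End WeaklyLindelof.

(* Main.v *)
Require Import Defs.
From mathcomp Require Import all_boot all_classical topology.

(** Swapping the topologies exchanges the two halves of pairwise weak
    Lindelofness, and each half passes to the semiregularization and back on its
    own ([weakly_lindelof_semireg]).

    Passing to the semiregularization only coarsens both topologies
    ([open_semireg_open]): there are fewer open covers to test, and closures
    are larger, so density of a countable subfamily is preserved.

    Conversely, fatten each member [U a] of a [ti]-open cover to the regular
    open set [ti]-int ([tj]-cl (U a)).  A countable subfamily [C] of the
    fattened cover is dense for the semiregularization of [tj], and the same
    indices work for the original cover.  Indeed, let [W] be the union of the
    [U a] for [a] in [C].  All the selected fattened sets lie in [tj]-cl W,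
    and the complement of [tj]-cl W is not only [tj]-open but
    [(tj, ti)]-regular open, because [W] is [ti]-open
    ([pair_regopen_setC_cl]).  So [tj]-cl W is closed in the
    semiregularization, and, containing a dense set, it is the whole space. *)

Local Open Scope classical_set_scope.

Section TwoTopologies.
Set Implicit Arguments.
Unset Strict Implicit.

Context {X : Type}.
Implicit Types (t s ti tj : Topological X) (A B : set X).

Lemma int_in_sub t A : int_in t A `<=` A.
Proof. exact: (@interior_subset (Topological.Pack t)). Qed.

Lemma open_int_in t A : open_in t (int_in t A).
Proof. exact: (@open_interior (Topological.Pack t)). Qed.

Lemma open_in_sub_int t A B : open_in t A -> A `<=` B -> A `<=` int_in t B.
Proof. by move=> oA; rewrite -(@open_subsetE (Topological.Pack t) A B oA). Qed.

Lemma sub_cl_in t A : A `<=` cl_in t A.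
Proof. exact: (@subset_closure (Topological.Pack t)). Qed.

Lemma cl_inS t A B : A `<=` B -> cl_in t A `<=` cl_in t B.
Proof. exact: (@closureS (Topological.Pack t)). Qed.

Lemma cl_in_idem t A : cl_in t (cl_in t A) = cl_in t A.
Proof.
apply/esym/(@closure_id (Topological.Pack t) (cl_in t A)).
exact: (@closed_closure (Topological.Pack t)).
Qed.

Lemma int_inC t A : int_in t (~` A) = ~` cl_in t A.
Proof. exact: (@interiorC (Topological.Pack t)). Qed.

Lemma cl_inC t A : cl_in t (~` A) = ~` int_in t A.
Proof. exact: (@closure_setC (Topological.Pack t)). Qed.

Lemma cl_in_closed t A : open_in t (~` A) -> cl_in t A `<=` A.
Proof.
move=> oCA; rewrite -[X in _ `<=` X]setCK -[X in cl_in t X]setCK cl_inC.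
by apply: subsetC; apply: open_in_sub_int.
Qed.

Lemma cl_in_coarser t s A :
  open_in s `<=` open_in t -> cl_in t A `<=` cl_in s A.
Proof.
move=> st; rewrite -[A]setCK !cl_inC; apply: subsetC.
by apply: open_in_sub_int; [apply/st/open_int_in | apply: int_in_sub].
Qed.

(** Both inclusions follow by applying [tj]-cl to the chain
    A <= [ti]-int ([tj]-cl A) <= [tj]-cl A, whose first step is where openness
    of [A] enters. *)
Lemma cl_int_cl ti tj A :
  open_in ti A -> cl_in tj (int_in ti (cl_in tj A)) = cl_in tj A.
Proof.
move=> oA; apply/seteqP; split.
  by rewrite -[X in _ `<=` X]cl_in_idem; apply: cl_inS; apply: int_in_sub.
by apply: cl_inS; apply: open_in_sub_int => //; apply: sub_cl_in.
Qed.

Lemma pair_regopen_int_cl ti tj A :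
  open_in ti A -> pair_regopen ti tj (int_in ti (cl_in tj A)).
Proof. by move=> oA; rewrite /pair_regopen cl_int_cl. Qed.

(** The set [tj]-int ([ti]-cl (~ [tj]-cl A)) is the complement of
    [tj]-cl ([ti]-int ([tj]-cl A)), so this is [cl_int_cl] again.  It is why
    the semiregularization does not enlarge the [tj]-closure of a [ti]-open
    set. *)
Lemma pair_regopen_setC_cl ti tj A :
  open_in ti A -> pair_regopen tj ti (~` cl_in tj A).
Proof. by move=> oA; rewrite /pair_regopen cl_inC int_inC cl_int_cl. Qed.

Lemma open_semiregE ti tj :
  open_in (semireg_topology ti tj) =
  [set \bigcup_(A in D) A
     | D in [set D | D `<=` finI_from (pair_regopen ti tj) id]].
Proof. by []. Qed.

Lemma pair_regopen_semireg ti tj A :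
  pair_regopen ti tj A -> open_in (semireg_topology ti tj) A.
Proof.
move=> rA; rewrite open_semiregE; exists [set A]; last exact: bigcup_set1.
by move=> _ ->; apply: (@finI_from1 _ _ _ id).
Qed.

Lemma open_semireg_open ti tj :
  open_in (semireg_topology ti tj) `<=` open_in ti.
Proof.
rewrite open_semiregE => _ [D DF <-].
apply: (@bigcup_open (Topological.Pack ti)) => B /DF [F FR <-].
rewrite openE => x Fx; apply: filter_bigI => A AF.
have rA : pair_regopen ti tj A by have /set_mem := FR A AF.
have oA : open_in ti A by rewrite -rA; apply: open_int_in.
exact: (open_in_sub_int oA (@subset_refl _ A) (Fx A AF)).
Qed.

Lemma weakly_lindelof_semireg ti tj :
  weakly_lindelof ti tj <->
  weakly_lindelof (semireg_topology ti tj) (semireg_topology tj ti).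
Proof.
split=> wl D U oU covU.
  have [C cC dC] := wl D U (fun a => @open_semireg_open ti tj _ (oU a)) covU.
  exists C => //; apply/seteqP; split=> // x _.
  by apply: (cl_in_coarser (@open_semireg_open tj ti)); rewrite dC.
have [||C cC dC] := wl D (fun a => int_in ti (cl_in tj (U a))).
- by move=> a; apply: pair_regopen_semireg; apply: pair_regopen_int_cl.
- apply/seteqP; split=> // x _.
  have [a _ Uax] : (\bigcup_a U a) x by rewrite covU.
  by exists a => //; apply: (open_in_sub_int (oU a) (@sub_cl_in tj (U a))).
exists C => //; set W := \bigcup_(a in C) U a.
have oW : open_in ti W
  by exact: (@bigcup_open (Topological.Pack ti) _ _ _ (fun a _ => oU a)).
have fatW : \bigcup_(a in C) int_in ti (cl_in tj (U a)) `<=` cl_in tj W.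
  move=> x [a Ca Ix]; apply: cl_inS (int_in_sub Ix) => y Uay.
  by exists a.
have clW : cl_in (semireg_topology tj ti) (cl_in tj W) `<=` cl_in tj W.
  apply: cl_in_closed; apply: pair_regopen_semireg.
  exact: pair_regopen_setC_cl.
by apply/seteqP; split=> // x _; apply/clW/(cl_inS fatW); rewrite dC.
Qed.

End TwoTopologies.

Theorem corollary4p10 (X : Type) (t1 t2 : Topological X) :
  pairwise_weakly_lindelof t1 t2 <->
  pairwise_weakly_lindelof (semireg_topology t1 t2) (semireg_topology t2 t1).
Proof.
rewrite /pairwise_weakly_lindelof.
by rewrite (propext (weakly_lindelof_semireg t1 t2))
           (propext (weakly_lindelof_semireg t2 t1)).
Qed.
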